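(* Let $G$ be the complete graph on a vertex set $V$ with $|V|=n\ge 2$, and consider the asynchronous pull voter model with agnostic nodes on $G$ with gnostic colours red and blue, in which the selected vertex chooses one of the other $n-1$ vertices uniformly at random. Let $S_0$ be the initial configuration, containing at least one gnostic node, let $I$ be the set of agnostic nodes of $S_0$, and let $\gamma$ be the proportion of red nodes among the gnostic nodes of $S_0$. Then $$\mathbb{P}(R(u)\mid S_0)=\gamma\quad\text{for all }u\in I,$$ where $R(u)$ is the event that $u$ takes colour red at the moment it first becomes gnostic. As a consequence, $$\mathbb{P}(\text{red wins}\mid S_0)=\gamma .$$
   Context: Asynchronous pull voter model with agnostic nodes on the complete graph: each node is, at each time, either agnostic (no colour) or gnostic; gnostic nodes are coloured red or blue. At each round one node $v$ is chosen uniformly at random from $V$, and $v$ selects a node $u\neq v$ uniformly at random among the other $n-1$ nodes. If $u$ is agnostic, $v$ keeps its current state; if $u$ is gnostic, $v$ copies the colour of $u$. All other nodes keep their state. Red wins means that a configuration in which all nodes are red is reached. *)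

(* Defs.v *)
From HB Require Import structures.
From mathcomp Require Import all_boot all_order all_algebra.
From mathcomp Require Import all_classical all_reals all_analysis.
Set Implicit Arguments.
Unset Strict Implicit.
Unset Printing Implicit Defensive.
Import Order.TTheory GRing.Theory Num.Theory.
Local Open Scope classical_set_scope.
Local Open Scope ring_scope.

Inductive color := Red | Blue.

Definition bool_of_color (c : color) : bool := if c is Red then true else false.
Definition color_of_bool (b : bool) : color := if b then Red else Blue.
Lemma bool_of_colorK : cancel bool_of_color color_of_bool.
Proof. by case. Qed.

HB.instance Definition _ := Finite.copy color (can_type bool_of_colorK).

(* [None] means agnostic, [Some c] means gnostic with colour [c]. *)
Definition config (V : finType) := {ffun V -> option color}.

Definition agnostics (V : finType) (S : config V) : {set V} :=
  [set v | S v == None]%SET.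
Definition gnostics (V : finType) (S : config V) : {set V} :=
  [set v | S v != None]%SET.
Definition reds (V : finType) (S : config V) : {set V} :=
  [set v | S v == Some Red]%SET.

Definition red_proportion (R : realType) (V : finType) (S : config V) : R :=
  #|reds S|%:R / #|gnostics S|%:R.

(* In a round [e = (v, u)], the selected vertex [v] pulls from [u]. *)
Definition pull (V : finType) (S : config V) (e : V * V) : config V :=
  if S e.2 is Some c then [ffun w => if w == e.1 then Some c else S w] else S.

Fixpoint trajectory (V : finType) (S0 : config V) (e : nat -> V * V)
    (t : nat) : config V :=
  if t is t'.+1 then pull (trajectory S0 e t') (e t') else S0.

(* Random variables with values in a finite set, so every [set E] is an event. *)
Definition mutually_independent d (T : measurableType d) (R : realType)
    (P : probability T R) (E : finType) (X : nat -> T -> E) : Prop :=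
  forall (J : seq nat) (A : nat -> set E), uniq J ->
    P (\big[setI/setT]_(t <- J) (X t @^-1` A t)) =
    (\prod_(t <- J) P (X t @^-1` A t))%E.

(* [X t w] is the pair (selected vertex, vertex it pulls from) of round [t].
   The selected vertex is uniform on [V] and, given it, the other one is uniform
   on the remaining [#|V| - 1] vertices. Measurability of the singleton events
   gives that of all events about [X t], since [V * V] is finite. *)
Definition uniform_pull_rounds d (T : measurableType d) (R : realType)
    (P : probability T R) (V : finType) (X : nat -> T -> V * V) : Prop :=
  [/\ forall t e, measurable (X t @^-1` [set e]),
      forall t v u, P (X t @^-1` [set (v, u)]) =
        (if u == v then 0 else #|V|%:R^-1 * #|V|.-1%:R^-1)%:E
    & mutually_independent P X].

Definition first_color_red (V : finType) (S0 : config V) (T : Type)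
    (X : nat -> T -> V * V) (u : V) : set T :=
  [set w | exists t : nat,
     trajectory S0 (X^~ w) t u = Some Red /\
     forall s : nat, (s < t)%N -> trajectory S0 (X^~ w) s u = None].

Definition red_wins (V : finType) (S0 : config V) (T : Type)
    (X : nat -> T -> V * V) : set T :=
  [set w | exists t : nat, forall v : V, trajectory S0 (X^~ w) t v = Some Red].

(* Main.v *)
(* With g gnostic vertices, r of them red, the proportion gamma = r / g is a
   martingale: recolourings between gnostic vertices cancel in pairs, and an
   agnostic vertex v that becomes gnostic turns red with probability gamma, so
   that the new proportion still has mean gamma. The same computation for v = u
   shows that the process equal to gamma until u is coloured, and from then on
   to the indicator that this first colour is red, is a martingale. Each claim
   is then absorption of a finite chain with a bounded harmonic function h,
   where a potential decreasing on average outside the target set and the zeros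
   of h replaces a recurrence argument. *)
Require Import Defs.
From HB Require Import structures.
From mathcomp Require Import all_boot all_order all_algebra.
From mathcomp Require Import all_classical all_reals all_analysis.
From mathcomp Require Import ring lra.
Set Implicit Arguments.
Unset Strict Implicit.
Unset Printing Implicit Defensive.
Import Order.TTheory GRing.Theory Num.Theory.
Local Open Scope classical_set_scope.
Local Open Scope ring_scope.

(** * Events of finite-valued random variables *)

Lemma measurable_preimage_fin d (T : measurableType d) (F : finType)
    (Z : T -> F) (A : set F) :
  (forall x, measurable (Z @^-1` [set x])) -> measurable (Z @^-1` A).
Proof.
move=> mZ.
have -> : Z @^-1` A = \bigcup_(x in A) Z @^-1` [set x].
  apply/seteqP; split => [w Aw|w [x Ax /= ->]] //=; by exists (Z w).
exact: fin_bigcup_measurable.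
Qed.

Lemma measure_partition_fin d (T : measurableType d) (R : realType)
    (P : {measure set T -> \bar R}) (F : finType) (Z : T -> F) (B : set T) :
  measurable B -> (forall x, measurable (Z @^-1` [set x])) ->
  P B = (\sum_(x : F) P (B `&` Z @^-1` [set x]))%E.
Proof.
move=> mB mZ.
have {1}-> : B = \bigcup_(x in [set: F]) (B `&` Z @^-1` [set x]).
  apply/seteqP; split => [w Bw|w [x _ []]] //; by exists (Z w).
rewrite measure_fin_bigcup //; first last.
- by move=> x _; exact: measurableI.
- apply/trivIsetP => x y _ _ xy; apply/seteqP; split => // w.
  by move=> [[_ /= zx] [_ /= zy]]; rewrite -zx -zy eqxx in xy.
- exact: finite_finset.
rewrite [RHS]fsbig_seq ?index_enum_uniq // (_ : [set` _] = setT) //.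
by apply/seteqP; split => x //= _; rewrite mem_index_enum.
Qed.

(** * Finite chains driven by independent inputs, and their absorption *)

Fixpoint run (S E : Type) (f : S -> E -> S) (s0 : S) (e : nat -> E)
    (t : nat) : S :=
  if t is t'.+1 then f (run f s0 e t') (e t') else s0.

Section MarkovChain.
Context d (T : measurableType d) (R : realType) (P : probability T R).
Context (S E : finType) (f : S -> E -> S) (X : nat -> T -> E) (s0 : S).
Hypothesis mX : forall t e, measurable (X t @^-1` [set e]).
Hypothesis indepX : mutually_independent P X.

Local Notation state t w := (run f s0 (X^~ w) t).

Lemma measurable_state t (A : set S) : measurable [set w | A (state t w)].
Proof.
elim: t A => [|t IH] A /=.
  have [As|nAs] := pselect (A s0).
    by rewrite (_ : [set _ | _] = setT) //; apply/seteqP; split.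
  by rewrite (_ : [set _ | _] = set0) //; apply/seteqP; split.
pose Z w := (state t w, X t w).
apply: (@measurable_preimage_fin _ _ _ Z [set z | A (f z.1 z.2)]) => -[s e].
rewrite (_ : _ @^-1` _ = [set w | [set s] (state t w)] `&` X t @^-1` [set e]).
  exact: measurableI.
by apply/seteqP; split => [w [<- <-]|w [/= <- <-]].
Qed.

(** The state at time [t] is a function of the inputs before [t], which are independent of those
    from [t] on. Constraints on a whole list [J] of later inputs are allowed so that the induction
    can move input [t] into the list. *)
Lemma state_indep_future t s (J : seq nat) (A : nat -> set E) :
  uniq J -> (forall j, j \in J -> (t <= j)%N) ->
  P ([set w | state t w = s] `&` \big[setI/setT]_(j <- J) X j @^-1` A j) =
  (P [set w | state t w = s] * P (\big[setI/setT]_(j <- J) X j @^-1` A j))%E.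
Proof.
have mB J' A' : measurable (\big[setI/setT]_(j <- J') X j @^-1` A' j).
  by apply: bigsetI_measurable => j _; exact: measurable_preimage_fin.
elim: t s J A => [|t IH] s J A uJ leJ /=.
  have [->|ns] := eqVneq s0 s.
    rewrite (_ : [set _ | _] = setT) ?setTI ?probability_setT ?mul1e //.
    by apply/seteqP; split.
  rewrite (_ : [set _ | _] = set0) ?set0I ?measure0 ?mul0e //.
  by apply/seteqP; split => // w /eqP; rewrite (negPf ns).
have tJ : t \notin J by apply/negP => /leJ; rewrite ltnn.
pose Z w := (state t w, X t w).
have mZ z : measurable (Z @^-1` [set z]).
  case: z => s1 e.
  rewrite (_ : _ @^-1` _ =
    [set w | [set s1] (state t w)] `&` X t @^-1` [set e]).
    by apply: measurableI => //; exact: measurable_state.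
  by apply/seteqP; split => [w [<- <-]|w [/= <- <-]].
(* Condition on the state and the input at time [t]. This is stated for sublists of [J] because it
   is used both for [J] and for the empty list. *)
have split_last J' A' : uniq J' -> {subset J' <= J} ->
    P ([set w | f (state t w) (X t w) = s] `&`
       \big[setI/setT]_(j <- J') X j @^-1` A' j) =
    (\sum_(z : S * E) if f z.1 z.2 == s then
      P [set w | state t w = z.1] * (P (X t @^-1` [set z.2]) *
      P (\big[setI/setT]_(j <- J') X j @^-1` A' j)) else 0)%E.
  move=> uJ' sJ'.
  have tJ' : t \notin J' by apply: contra tJ => /sJ'.
  rewrite (measure_partition_fin P _ mZ); last first.
    by apply: measurableI => //; exact: (@measurable_state t.+1 [set s]).
  apply: eq_bigr => -[s1 e] _ /=; case: eqP => [fs|nfs]; last first.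
    rewrite [X in P X](_ : _ = set0) ?measure0 //.
    apply/seteqP; split => // w [[/= fw _] [z1 z2]].
    by apply: nfs; rewrite -z1 -z2.
  (* Input [t] is fixed to [e] and the later constraints are kept; since [t] is not in [J'], the two
     do not interfere. *)
  pose A1 j := if j == t then [set e] else A' j.
  have A1J : \big[setI/setT]_(j <- J') X j @^-1` A1 j =
             \big[setI/setT]_(j <- J') X j @^-1` A' j.
    apply: eq_big_seq => j jJ'; rewrite /A1; case: eqP => // jt.
    by rewrite -jt jJ' in tJ'.
  have A1P : (\prod_(j <- J') P (X j @^-1` A1 j) =
              \prod_(j <- J') P (X j @^-1` A' j))%E.
    apply: eq_big_seq => j jJ'; rewrite /A1; case: eqP => // jt.
    by rewrite -jt jJ' in tJ'.
  have utJ' : uniq (t :: J') by rewrite /= tJ'.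
  have := IH s1 (t :: J') A1 utJ'.
  rewrite (indepX A1 utJ') !big_cons A1J A1P -(indepX A' uJ') /A1 eqxx.
  move=> <- => [|j].
    congr (P _); apply/seteqP; split => w /=.
      by move=> [[_ ?] [<- <-]].
    by move=> [z1 [z2 ?]]; rewrite /Z z1 z2.
  by rewrite inE => /orP[/eqP -> //|/sJ'/leJ/ltnW].
have /= := split_last J A uJ (fun _ => id).
(* Without future constraints the sum is the probability of state [s] at time [t.+1]; the sum for
   [J] is this one times a common factor. *)
have /= := split_last [::] A isT (fun j => _).
rewrite !big_nil !setIT => -> // ->.
rewrite ge0_sume_distrl; last first.
  by move=> z _; case: ifP => // _; rewrite !mule_ge0.
apply: eq_bigr => z _; case: ifP => _; last by rewrite mul0e.
by rewrite probability_setT mule1 muleA.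
Qed.
Context (p : E -> R).
Hypothesis lawX : forall t e, P (X t @^-1` [set e]) = (p e)%:E.

Definition state_law t s : R := fine (P [set w | state t w = s]).

Definition state_mean t (phi : S -> R) : R := \sum_s state_law t s * phi s.

Lemma state_lawE t s : P [set w | state t w = s] = (state_law t s)%:E.
Proof.
rewrite fineK // fin_num_measure //.
exact: (@measurable_state t [set s]).
Qed.

Lemma state_law_ge0 t s : 0 <= state_law t s.
Proof. exact: fine_ge0. Qed.

Lemma state_meanE t (A : pred S) :
  P [set w | A (state t w)] = (state_mean t (fun s => (A s)%:R))%:E.
Proof.
rewrite (@measure_partition_fin _ _ _ P _ (fun w => state t w)); last first.
- by move=> s; exact: (@measurable_state t [set s]).
- exact: (@measurable_state t A).
rewrite -sumEFin; apply: eq_bigr => s _ /=.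
case As : (A s).
  rewrite mulr1 -state_lawE; congr (P _); apply/seteqP; split => w /=.
    by case.
  by move=> ->.
rewrite mulr0 [X in P X](_ : _ = set0) ?measure0 //.
by apply/seteqP; split => // w [/= + ws]; rewrite ws As.
Qed.

Lemma state_mean0 phi : state_mean 0 phi = phi s0.
Proof.
rewrite /state_mean (bigD1 s0) //= big1 ?addr0 => [|s /eqP ns].
  rewrite /state_law /= (_ : [set _ | _] = setT) ?probability_setT ?mul1r //.
  by apply/seteqP; split.
rewrite /state_law /= (_ : [set _ | _] = set0) ?measure0 ?mul0r //.
by apply/seteqP; split => // w /esym.
Qed.

Lemma state_lawS t s : state_law t.+1 s =
  \sum_(z : S * E) (f z.1 z.2 == s)%:R * (state_law t z.1 * p z.2).
Proof.
apply: EFin_inj; rewrite -state_lawE -sumEFin.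
pose Z w := (state t w, X t w).
have ZE s1 e : Z @^-1` [set (s1, e)] =
    [set w | state t w = s1] `&` X t @^-1` [set e].
  by apply/seteqP; split => [w [<- <-]|w [/= <- <-]].
rewrite (@measure_partition_fin _ _ _ P _ Z); last first.
- move=> [s1 e]; rewrite ZE; apply: measurableI => //.
  exact: (@measurable_state t [set s1]).
- exact: (@measurable_state t.+1 [set s]).
apply: eq_bigr => -[s1 e] _ /=; case: eqP => [fs|nfs].
  have := @state_indep_future t s1 [:: t] (fun=> [set e]) isT.
  rewrite !big_seq1 lawX state_lawE -EFinM mul1r => <- => [|j]; last first.
    by rewrite inE => /eqP ->.
  congr (P _); rewrite ZE; apply/seteqP; split => w /=.
    by case.
  by move=> [z1 z2]; rewrite z1 z2.
rewrite mul0r [X in P X](_ : _ = set0) ?measure0 //.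
apply/seteqP; split => // w [/= fw [z1 z2]].
by apply: nfs; rewrite -z1 -z2.
Qed.

Lemma state_meanS t phi :
  state_mean t.+1 phi = state_mean t (fun s => \sum_e p e * phi (f s e)).
Proof.
rewrite /state_mean.
under eq_bigr do rewrite state_lawS mulr_suml.
rewrite exchange_big /= [RHS](_ : _ =
  \sum_s \sum_e state_law t s * p e * phi (f s e)); last first.
  apply: eq_bigr => s _; rewrite mulr_sumr; apply: eq_bigr => e _.
  by rewrite mulrA.
rewrite [RHS]pair_bigA /=; apply: eq_bigr => -[s e] _ /=.
rewrite (bigD1 (f s e)) //= eqxx mul1r big1 ?addr0 // => s' ns.
by rewrite eq_sym (negPf ns) !mul0r.
Qed.

Lemma state_mean_le t phi1 phi2 :
  (forall s, phi1 s <= phi2 s) -> state_mean t phi1 <= state_mean t phi2.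
Proof.
by move=> le12; apply: ler_sum => s _; rewrite ler_wpM2l ?state_law_ge0.
Qed.

Lemma state_meanD t phi1 phi2 :
  state_mean t (fun s => phi1 s + phi2 s) =
  state_mean t phi1 + state_mean t phi2.
Proof. by rewrite -big_split; apply: eq_bigr => s _; rewrite mulrDr. Qed.

Lemma state_meanZ t c phi :
  state_mean t (fun s => c * phi s) = c * state_mean t phi.
Proof. by rewrite mulr_sumr; apply: eq_bigr => s _; rewrite mulrCA. Qed.

Lemma harmonic_state_mean h t :
  (forall s, \sum_e p e * h (f s e) = h s) -> state_mean t h = h s0.
Proof.
move=> hh; elim: t => [|t IH]; first exact: state_mean0.
by rewrite state_meanS -IH; apply: eq_bigr => s _; rewrite hh.
Qed.

(** Since [A] is closed under [f], the events of being in [A] at time [t] increase to the event of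
    ever reaching it. The mean of [h] stays at [h s0] and dominates each of their probabilities,
    which gives the upper bound. For the lower bound, [h] is at most the indicator of [A] plus that
    of the states outside [A] where [h] is nonzero, and [psi] shows that the chain cannot keep
    visiting the latter with probability bounded below. *)
Lemma absorption_probability (A : pred S) (h psi : S -> R) :
  (forall s e, A s -> A (f s e)) ->
  (forall s, \sum_e p e * h (f s e) = h s) ->
  (forall s, (A s)%:R <= h s <= 1) ->
  (forall s, 0 <= psi s) ->
  (forall s, \sum_e p e * psi (f s e) <= psi s) ->
  (forall s, ~~ A s -> h s != 0 -> \sum_e p e * psi (f s e) < psi s) ->
  P [set w | exists t, A (state t w)] = (h s0)%:E.
Proof.
move=> Af hh hA psi0 psi_le psi_lt.
pose F t := [set w | A (state t w)].
have mF t : measurable (F t) by exact: (@measurable_state t A).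
have -> : [set w | exists t, A (state t w)] = \bigcup_t F t.
  by apply/seteqP; split => [w [t]|w [t _]]; exists t.
have mUF : measurable (\bigcup_t F t) by exact: bigcupT_measurable.
have ndF : {homo F : m n / (m <= n)%N >-> (m <= n)%O}.
  move=> m n /subnK <-; elim: (n - m)%N => [|k IH]; first by rewrite add0n.
  apply/subsetPset => w /(subsetPset _ _ IH); rewrite /F addSn /=; exact: Af.
have hF t : h s0 = state_mean t h by rewrite harmonic_state_mean.
apply/eqP; rewrite eq_le; apply/andP; split.
  apply: cvge_to_le (nondecreasing_cvg_mu mF mUF ndF) _.
  apply: nearW => t; rewrite /= state_meanE lee_fin (hF t).
  by apply: state_mean_le => s; case/andP: (hA s).
(* The expected drops of [psi] telescope, so the total time spent in [bad]
   states has mean at most [psi s0 / c]. *)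
pose bad s := ~~ A s && (h s != 0).
pose drop s := psi s - \sum_e p e * psi (f s e).
(* The least drop over the finitely many bad states; the default 1 keeps [c] positive when there are
   none. *)
pose c := \big[Num.min/1]_(s | bad s) drop s.
have c0 : 0 < c.
  by apply: lt_bigmin => // s /andP[As hs]; rewrite subr_gt0 psi_lt.
have bad_drop s : c * (bad s)%:R <= drop s.
  case: (boolP (bad s)) => bs; first by rewrite mulr1 bigmin_le_cond.
  by rewrite mulr0 subr_ge0.
have drop_sum N : \sum_(t < N) state_mean t drop = psi s0 - state_mean N psi.
  elim: N => [|N IH]; first by rewrite big_ord0 state_mean0 subrr.
  rewrite big_ord_recr /= IH state_meanD state_meanS.
  rewrite (_ : state_mean N (fun s => - _) =
    - state_mean N (fun s => \sum_e p e * psi (f s e))); first by ring.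
  by rewrite -mulN1r -state_meanZ; apply: eq_bigr => s _; rewrite mulN1r.
have PUF : P (\bigcup_t F t) = (fine (P (\bigcup_t F t)))%:E.
  by rewrite fineK // fin_num_measure.
rewrite PUF lee_fin; set q := fine _ in PUF *.
(* A state that is neither bad nor in [A] has [h] equal to 0, and the probability of being in [A] at
   time [t] is at most [q]. *)
have gap t : h s0 - q <= state_mean t (fun s => (bad s)%:R).
  rewrite lerBlDr (hF t).
  apply: (@le_trans _ _ (state_mean t (fun s => (bad s)%:R + (A s)%:R))).
    apply: state_mean_le => s; case/andP: (hA s) => _ h1.
    rewrite /bad; case: (A s); rewrite /= ?add0r // addr0.
    by case: eqP => [->|].
  rewrite state_meanD lerD2l -lee_fin -state_meanE -PUF.
  apply: le_measure; rewrite ?inE; [exact: mF|exact: mUF|].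
  by move=> w; exists t.
rewrite leNgt; apply/negP; rewrite -subr_gt0 => eps0.
(* A positive gap would cost at least [c * (h s0 - q)] of mean potential in every round, which the
   finite budget [psi s0] cannot pay for large [N]. *)
have bound N : N%:R * (c * (h s0 - q)) <= psi s0.
  apply: (@le_trans _ _ (\sum_(t < N) state_mean t drop)).
    rewrite mulr_natl -[N in _ *+ N]card_ord -sumr_const.
    apply: ler_sum => t _.
    apply: (@le_trans _ _ (state_mean t (fun s => c * (bad s)%:R))).
      by rewrite state_meanZ ler_wpM2l // ltW.
    exact: state_mean_le.
  rewrite drop_sum gerBl; apply: sumr_ge0 => s _.
  by rewrite mulr_ge0 ?state_law_ge0.
have ceps : 0 < c * (h s0 - q) by rewrite mulr_gt0.
have := archi_boundP (divr_ge0 (psi0 s0) (ltW ceps)).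
by rewrite ltr_pdivrMr // ltNge bound.
Qed.

End MarkovChain.

(** * Counts of vertices and the drift of the red proportion *)

Section PullRounds.
Context (R : realType) (V : finType).
Implicit Types (S : config V) (u v w : V).

(** The predicate is a parameter so that a single update rule covers the numbers of red, gnostic and
    agnostic vertices. *)
Definition state_count (q : pred (option color)) S : R := \sum_w (q (S w))%:R.

Local Notation red := (pred1 (Some Red)).
Local Notation gnostic := (predC1 (@None color)).
Local Notation gamma := (red_proportion R).

Lemma state_count_card (q : pred (option color)) S :
  state_count q S = #|[set w | q (S w)]%SET|%:R.
Proof.
rewrite /state_count -sum1_card natr_sum [RHS]big_mkcond /=.
by apply: eq_bigr => w _; rewrite inE; case: (q _).
Qed.

Lemma red_proportionE S : gamma S = state_count red S / state_count gnostic S.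
Proof. by rewrite !state_count_card. Qed.

Lemma state_count_ge0 q S : 0 <= state_count q S.
Proof. by rewrite state_count_card. Qed.

Lemma state_count_gt0 (q : pred (option color)) S w :
  q (S w) -> 0 < state_count q S.
Proof.
move=> qw; rewrite state_count_card ltr0n.
by apply/card_gt0P; exists w; rewrite inE.
Qed.

Lemma state_count_red_le S : state_count red S <= state_count gnostic S.
Proof. by apply: ler_sum => w _; case: (S w) => [[]|]. Qed.

(* Also covers [gamma S = 0 / 0 = 0] when nobody is gnostic. *)
Lemma gnostic_mul_proportion S :
  state_count gnostic S * gamma S = state_count red S.
Proof.
rewrite red_proportionE; have [g0|gN0] := eqVneq (state_count gnostic S) 0.
  rewrite g0 mul0r; apply/eqP; rewrite eq_le state_count_ge0.
  by rewrite -g0 state_count_red_le.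
by rewrite mulrCA divff ?mulr1.
Qed.

Lemma red_proportion_ge0 S : 0 <= gamma S.
Proof. by rewrite divr_ge0. Qed.

Lemma red_proportion_le1 S : gamma S <= 1.
Proof.
rewrite red_proportionE; have [->|gN0] := eqVneq (state_count gnostic S) 0.
  by rewrite invr0 mulr0.
rewrite ler_pdivrMr ?mul1r ?state_count_red_le //.
by rewrite lt_neqAle eq_sym gN0 state_count_ge0.
Qed.

Lemma red_proportion_neq0 S : gamma S != 0 -> exists w, S w = Some Red.
Proof.
move=> gN0; have [w /eqP Sw|nored] := pickP (fun w => red (S w)).
  by exists w.
by rewrite red_proportionE [state_count red S]big1 ?mul0r ?eqxx // in gN0 *;
  move=> w _; have /= -> := nored w.
Qed.

(** Lets the sums below run over all pairs, including the diagonal ones that no round selects. *)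
Lemma pull_diag S v : pull S (v, v) = S.
Proof.
rewrite /pull /=; case Sv : (S v) => [c|] //.
by apply/ffunP => w; rewrite ffunE; case: eqP => // ->.
Qed.

Lemma pull_agnostic S v u : S u = None -> pull S (v, u) = S.
Proof. by rewrite /pull /= => ->. Qed.

Lemma pull_gnosticE S v u c w : S u = Some c ->
  pull S (v, u) w = if w == v then Some c else S w.
Proof. by rewrite /pull /= => ->; rewrite ffunE. Qed.

Lemma state_count_pull (q : pred (option color)) S v u c : S u = Some c ->
  state_count q (pull S (v, u)) =
  state_count q S + (q (Some c))%:R - (q (S v))%:R.
Proof.
move=> Su; rewrite /state_count (bigD1 v) //= [in RHS](bigD1 v) //=.
rewrite (pull_gnosticE _ _ Su) eqxx.
rewrite (eq_bigr (fun w => (q (S w))%:R)); first by ring.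
by move=> w wv; rewrite (pull_gnosticE _ _ Su) (negPf wv).
Qed.

(** Each of the [g] gnostic choices of [u] gives the proportion [r / (g + 1)], plus [1 / (g + 1)] if
    [u] is red. The new values add up to [(g * r + r) / (g + 1) = r], and so do the [g] copies of
    [gamma S]. *)
Lemma pull_drift_agnostic S v : S v = None ->
  \sum_u (gamma (pull S (v, u)) - gamma S) = 0.
Proof.
move=> Sv.
set g := state_count gnostic S; set r := state_count red S.
have g0 : 0 <= g := state_count_ge0 _ _.
rewrite (eq_bigr (fun u => (gnostic (S u))%:R * (r / (g + 1) - gamma S)
    + (red (S u))%:R / (g + 1))); last first.
  move=> u _; case Su : (S u) => [c|]; last first.
    by rewrite pull_agnostic // subrr !mul0r addr0.
  rewrite {1}red_proportionE !(state_count_pull _ _ Su) Sv -/g -/r /=.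
  by rewrite mul1r !subr0 mulrDl addrAC.
rewrite big_split /= -!mulr_suml -/g -/r -/(state_count gnostic S).
rewrite -/(state_count red S) -/g -/r mulrBr gnostic_mul_proportion -/r.
by field; rewrite gt_eqF // ltr_wpDl.
Qed.

(** The number [g] of gnostics is unchanged, so a gnostic [u] moves the proportion by the difference
    of the red indicators of [u] and [v], divided by [g]. *)
Lemma pull_drift_gnostic S v : S v != None ->
  \sum_u (gamma (pull S (v, u)) - gamma S) = gamma S - (red (S v))%:R.
Proof.
move=> Sv.
have g0 : 0 < state_count gnostic S by exact: (@state_count_gt0 _ _ v).
rewrite (eq_bigr (fun u => (red (S u))%:R / state_count gnostic S
    - (gnostic (S u))%:R * ((red (S v))%:R / state_count gnostic S)));
  last first.
  move=> u _; case Su : (S u) => [c|]; last first.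
    by rewrite pull_agnostic // subrr !mul0r subrr.
  rewrite !red_proportionE !(state_count_pull _ _ Su) /= Sv mul1r addrK.
  by field; rewrite gt_eqF.
rewrite sumrB -!mulr_suml -!/(state_count _ S) -red_proportionE.
by rewrite mulrCA divff ?mulr1 ?gt_eqF.
Qed.

(** Agnostic rows vanish one by one, but gnostic rows only in total: they add up to
    [g * gamma S - r]. *)
Lemma pull_drift S : \sum_v \sum_u (gamma (pull S (v, u)) - gamma S) = 0.
Proof.
rewrite (eq_bigr (fun v => (gnostic (S v))%:R * gamma S - (red (S v))%:R)).
  rewrite sumrB -mulr_suml -!/(state_count _ S) gnostic_mul_proportion.
  exact: subrr.
move=> v _; case Sv : (S v) => [c|].
  by rewrite pull_drift_gnostic Sv // mul1r.
by rewrite pull_drift_agnostic // mul0r subr0.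
Qed.

(** * Averages over one round and the potential for consensus *)

Definition round_law (e : V * V) : R :=
  if e.2 == e.1 then 0 else #|V|%:R^-1 * #|V|.-1%:R^-1.

Hypothesis hn : (2 <= #|V|)%N.

Let kappa : R := #|V|%:R^-1 * #|V|.-1%:R^-1.

Let kappa_gt0 : 0 < kappa.
Proof. by rewrite mulr_gt0 // invr_gt0 ltr0n; case: #|V| hn => [|[]]. Qed.

Lemma round_law_sum : \sum_e round_law e = 1.
Proof.
rewrite -(pair_bigA _ (fun v u => round_law (v, u))) /=.
rewrite (eq_bigr (fun=> #|V|%:R^-1)) => [|v _].
  by rewrite sumr_const -[LHS]mulr_natr mulVf // pnatr_eq0 -lt0n ltnW.
rewrite (bigD1 v) //= /round_law eqxx add0r.
rewrite (eq_bigr (fun=> kappa)) => [|u /negPf -> //].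
rewrite sumr_const cardC1 -[LHS]mulr_natr -mulrA mulVf ?mulr1 //.
by rewrite pnatr_eq0 -lt0n; case: #|V| hn => [|[]].
Qed.

(** The law is the constant [kappa] off the diagonal and 0 on it. Subtracting the diagonal value [c]
    kills the diagonal terms, so the sum on the right needs no restriction to distinct vertices. *)
Lemma round_mean (phi : V * V -> R) c : (forall v, phi (v, v) = c) ->
  \sum_e round_law e * phi e = c + kappa * \sum_v \sum_u (phi (v, u) - c).
Proof.
move=> phi_diag; rewrite pair_bigA mulr_sumr.
rewrite -[X in X + _]mul1r -round_law_sum mulr_suml -big_split.
apply: eq_bigr => -[v u] _ /=.
rewrite /round_law /=; case: eqP => [->|_]; last by rewrite -/kappa; ring.
by rewrite phi_diag subrr !mul0r mulr0 addr0.
Qed.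

Lemma round_mean_le (phi : V * V -> R) c : (forall v, phi (v, v) = c) ->
  (forall v u, phi (v, u) <= c) -> \sum_e round_law e * phi e <= c.
Proof.
move=> phi_diag phi_le; rewrite (round_mean phi_diag) gerDl.
rewrite pmulr_rle0 //; apply: sumr_le0 => v _; apply: sumr_le0 => u _.
by rewrite subr_le0.
Qed.

(** A strict inequality at [(v0, u0)] already forces the two vertices to be distinct, so this pair
    has positive probability. *)
Lemma round_mean_lt (phi : V * V -> R) c v0 u0 : (forall v, phi (v, v) = c) ->
  (forall v u, phi (v, u) <= c) -> phi (v0, u0) < c ->
  \sum_e round_law e * phi e < c.
Proof.
move=> phi_diag phi_le phi_lt; rewrite (round_mean phi_diag) gtrDl.
rewrite pmulr_rlt0 // pair_bigA (bigD1 (v0, u0)) //=.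
rewrite ltr_wnDr ?subr_lt0 //.
by apply: sumr_le0 => -[v u] _; rewrite subr_le0.
Qed.

Lemma red_proportion_harmonic S :
  \sum_e round_law e * gamma (pull S e) = gamma S.
Proof.
rewrite (@round_mean (fun e => gamma (pull S e)) (gamma S)).
  by rewrite pull_drift mulr0 addr0.
by move=> v; rewrite pull_diag.
Qed.

(* Agnostics disappear at a positive rate, and the variance of the martingale
   [gamma] makes [gamma ^+ 2] a submartingale. *)
Definition consensus_potential S : R :=
  state_count (pred1 None) S + (1 - gamma S ^+ 2).

Lemma consensus_potential_ge0 S : 0 <= consensus_potential S.
Proof.
rewrite addr_ge0 ?state_count_ge0 // subr_ge0 expr_le1 ?red_proportion_ge0 //.
exact: red_proportion_le1.
Qed.

(** The potential after the round plus [2 * gamma S] times the increment of [gamma], a correction of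
    mean zero. Unlike the new potential itself, this is bounded by the old potential for every pair
    [e], not only on average. *)
Let drop S e : R := state_count (pred1 None) (pull S e)
  - (gamma (pull S e) - gamma S) ^+ 2 + (1 - gamma S ^+ 2).

Let consensus_potential_mean S :
  \sum_e round_law e * consensus_potential (pull S e) =
  \sum_e round_law e * drop S e.
Proof.
rewrite (eq_bigr (fun e => round_law e * drop S e
   - 2 * gamma S * (round_law e * gamma (pull S e) - round_law e * gamma S))).
  rewrite sumrB -mulr_sumr sumrB red_proportion_harmonic -mulr_suml.
  by rewrite round_law_sum mul1r subrr mulr0 subr0.
by move=> e _; rewrite /drop /consensus_potential; ring.
Qed.

Let drop_diag S v : drop S (v, v) = consensus_potential S.
Proof. by rewrite /drop pull_diag subrr expr0n subr0. Qed.

Lemma agnostic_count_pull S v u :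
  state_count (pred1 None) (pull S (v, u)) <= state_count (pred1 None) S.
Proof.
case Su : (S u) => [c|]; last by rewrite pull_agnostic.
by rewrite (state_count_pull _ _ Su) /= addr0 gerBl.
Qed.

Let drop_le S v u : drop S (v, u) <= consensus_potential S.
Proof.
rewrite lerD2r -[leRHS]subr0 lerB ?sqr_ge0 //; exact: agnostic_count_pull.
Qed.

Lemma consensus_potential_le S :
  \sum_e round_law e * consensus_potential (pull S e) <= consensus_potential S.
Proof. by rewrite consensus_potential_mean round_mean_le. Qed.

(** A nonzero [gamma] provides a red vertex [w] to pull from. If some vertex is agnostic, its pull
    from [w] lowers the agnostic count; otherwise the pull of a non-red [b] from [w] changes [gamma]
    by [1 / g], and the squared increment is positive. *)
Lemma consensus_potential_lt S :
  ~~ [forall v, S v == Some Red] -> gamma S != 0 ->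
  \sum_e round_law e * consensus_potential (pull S e) < consensus_potential S.
Proof.
move=> /forallPn[b Sb] /red_proportion_neq0[w Sw].
rewrite consensus_potential_mean.
have [v /eqP Sv|full] := pickP (fun v => S v == None).
  apply: (@round_mean_lt _ _ v w) => //; rewrite ltrD2r.
  rewrite (state_count_pull _ _ Sw) Sv /= addr0.
  by have := sqr_ge0 (gamma (pull S (v, w)) - gamma S); lra.
apply: (@round_mean_lt _ _ b w) => //; rewrite ltrD2r.
rewrite (state_count_pull _ _ Sw) /= full addr0 subr0 ltrBlDr ltrDl.
rewrite exprn_even_gt0 //=.
have g0 : 0 < state_count gnostic S.
  by apply: (@state_count_gt0 _ _ w); rewrite Sw.
rewrite !red_proportionE !(state_count_pull _ _ Sw) /= full (negPf Sb).
rewrite subr0 addrK -mulrBl addrAC subrr add0r mulf_neq0 ?invr_eq0 ?gt_eqF //.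
Qed.

(** * The chain stopped when [u] is coloured *)

(** Stopping keeps the first colour of [u] visible in the current state, which turns a condition on
    the whole path into the absorption of a chain. *)
Definition frozen_pull u S e : config V := if S u == None then pull S e else S.

Definition first_color_value u S : R :=
  if S u is Some c then (c == Red)%:R else gamma S.

(** For agnostic [u], the rounds in which [u] pulls contribute [r - g * gamma S = 0]. In all other
    rounds [u] stays agnostic and the value is [gamma]; their total drift is zero because both the
    full drift and the row of [u] in it vanish. *)
Lemma first_color_harmonic u S :
  \sum_e round_law e * first_color_value u (frozen_pull u S e) =
  first_color_value u S.
Proof.
rewrite /frozen_pull; case Su : (S u) => [c|] /=.
  by rewrite -mulr_suml round_law_sum mul1r.
rewrite (@round_mean _ (gamma S)) => [|v]; last first.
  by rewrite pull_diag /first_color_value Su.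
rewrite {2}/first_color_value Su -[RHS]addr0; congr (_ + _).
rewrite (bigD1 u) //= (eq_bigr (fun w =>
  (red (S w))%:R - (gnostic (S w))%:R * gamma S)); last first.
  move=> w _; case Sw : (S w) => [c|].
    by rewrite /first_color_value (pull_gnosticE _ _ Sw) eqxx mul1r.
  by rewrite pull_agnostic // /first_color_value Su mul0r !subrr.
rewrite sumrB -mulr_suml -!/(state_count _ S) gnostic_mul_proportion.
rewrite subrr add0r.
rewrite (eq_bigr (fun v => \sum_w (gamma (pull S (v, w)) - gamma S))).
  have := pull_drift S; rewrite (bigD1 u) //=.
  rewrite pull_drift_agnostic // add0r => ->.
  by rewrite mulr0.
move=> v vu; apply: eq_bigr => w _; rewrite /first_color_value.
have -> : pull S (v, w) u = None; last by [].
case Sw : (S w) => [c|]; last by rewrite pull_agnostic.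
by rewrite (pull_gnosticE _ _ Sw) eq_sym (negPf vu).
Qed.

Lemma still_agnostic_le u S :
  \sum_e round_law e * (frozen_pull u S e u == None)%:R <= (S u == None)%:R.
Proof.
rewrite /frozen_pull; case: (eqVneq (S u) None) => [Su|/negPf Su].
  apply: round_mean_le => [v|v w]; first by rewrite pull_diag Su.
  by rewrite ler_nat; case: (_ == _).
by rewrite Su big1 // => e _; rewrite mulr0.
Qed.

Lemma still_agnostic_lt u S : S u = None -> gamma S != 0 ->
  \sum_e round_law e * (frozen_pull u S e u == None)%:R < (S u == None)%:R.
Proof.
move=> Su /red_proportion_neq0[w Sw]; rewrite /frozen_pull Su /=.
apply: (@round_mean_lt _ _ u w) => [v|v x|]; first by rewrite pull_diag Su.
  by rewrite ler_nat; case: (_ == _).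
by rewrite (pull_gnosticE _ _ Sw) eqxx ltr01.
Qed.

End PullRounds.

(** * From trajectories to runs, and the two absorption probabilities *)

Lemma trajectory_run (V : finType) (S0 : config V) e t :
  trajectory S0 e t = run (@pull V) S0 e t.
Proof. by elim: t => //= t ->. Qed.

Lemma frozen_run_stable (V : finType) (S0 : config V) u e m t : (m <= t)%N ->
  run (frozen_pull u) S0 e m u != None ->
  run (frozen_pull u) S0 e t = run (frozen_pull u) S0 e m.
Proof.
move=> /subnK <- um; elim: (t - m)%N => //= k ->.
by rewrite /frozen_pull (negPf um).
Qed.

Lemma frozen_run_trajectory (V : finType) (S0 : config V) u e t :
  (forall s, (s < t)%N -> trajectory S0 e s u = None) ->
  run (frozen_pull u) S0 e t = trajectory S0 e t.
Proof.
elim: t => //= t IH un; rewrite IH => [|s st]; last exact/un/ltnW.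
by rewrite /frozen_pull un ?eqxx.
Qed.

(** Let [m] be the first time at which [u] is gnostic in the stopped run. Up to [m] this run agrees
    with the trajectory, and afterwards it is constant, so a red [u] at any later time was already
    red at [m]. *)
Lemma first_color_red_run (V : finType) (S0 : config V) (T : Type)
    (X : nat -> T -> V * V) u :
  first_color_red S0 X u =
  [set w | exists t, run (frozen_pull u) S0 (X^~ w) t u == Some Red].
Proof.
apply/seteqP; split => w /= [t].
  by move=> [tred un]; exists t; rewrite frozen_run_trajectory // tred.
move=> /eqP tred.
have ex : exists m, run (frozen_pull u) S0 (X^~ w) m u != None.
  by exists t; rewrite tred.
case: (ex_minnP ex) => m um min_m.
have mt : (m <= t)%N by apply: min_m; rewrite tred.
have eqm k : (k <= m)%N ->
    run (frozen_pull u) S0 (X^~ w) k = trajectory S0 (X^~ w) k.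
  elim: k => // k IH km /=; rewrite -IH ?(ltnW km) // /frozen_pull.
  by case: eqP => // /eqP /min_m; rewrite leqNgt km.
exists m; split => [|s sm].
  by rewrite -eqm // -(frozen_run_stable mt um).
rewrite -eqm ?(ltnW sm) //; apply/eqP/negPn/negP => /min_m.
by rewrite leqNgt sm.
Qed.

Theorem proposition5 (R : realType) (V : finType) (n : nat)
  (hV : #|V| = n) (hn : (2 <= n)%N)
  (d : measure_display) (T : measurableType d) (P : probability T R)
  (X : nat -> T -> V * V) (hX : uniform_pull_rounds P X)
  (S0 : config V) (hS0 : (0 < #|gnostics S0|)%N) :
  (forall u : V, u \in agnostics S0 ->
     P (first_color_red S0 X u) = (red_proportion R S0)%:E) /\
  P (red_wins S0 X) = (red_proportion R S0)%:E.
Proof.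
have V2 : (2 <= #|V|)%N by rewrite hV.
have [mX lawX indepX] := hX.
have lawE t e : P (X t @^-1` [set e]) = (round_law R e)%:E.
  by case: e => v u; exact: lawX.
split => [u|].
  rewrite inE => /eqP u0; rewrite first_color_red_run.
  have <- : first_color_value R u S0 = red_proportion R S0.
    by rewrite /first_color_value u0.
  apply: (@absorption_probability _ _ _ P _ _ (frozen_pull u) X S0 mX indepX
    _ lawE (fun S => S u == Some Red) (first_color_value R u)
    (fun S => (S u == None)%:R)) => //.
  - by move=> S e /= /eqP Su; rewrite /frozen_pull Su /= Su.
  - exact: (first_color_harmonic R V2 u).
  - move=> S; rewrite /first_color_value; case: (S u) => [[]|] /=.
    + by rewrite ler_nat.
    + by rewrite lexx ler01.
    + by rewrite red_proportion_ge0 red_proportion_le1.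
  - exact: (still_agnostic_le R V2 u).
  (* A blue [u] is a zero of the harmonic function, so only an agnostic [u] requires a strict
     decrease. *)
  - move=> S; rewrite /first_color_value.
    case Su : (S u) => [[]|] //= _; first by rewrite eqxx.
    by move=> g0; have := still_agnostic_lt V2 Su g0; rewrite Su.
have -> : red_wins S0 X = [set w | exists t,
    [forall v, run (@pull V) S0 (X^~ w) t v == Some Red]].
  apply/seteqP; split => w /= [t allred]; exists t.
    by apply/forallP => v; rewrite -trajectory_run allred.
  by move=> v; rewrite trajectory_run; apply/eqP/(forallP allred).
apply: (@absorption_probability _ _ _ P _ _ (@pull V) X S0 mX indepX
  _ lawE (fun S => [forall v, S v == Some Red]) (@red_proportion R V)
  (@consensus_potential R V)).
- move=> S [v u] /forallP red; apply/forallP => w.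
  by rewrite (pull_gnosticE _ _ (eqP (red u))); case: ifP.
- exact: (red_proportion_harmonic R V2).
- move=> S; rewrite red_proportion_le1 andbT.
  case: forallP => [red|_]; last exact: red_proportion_ge0.
  have reds_all : reds S = gnostics S.
    by apply/setP => v; rewrite !inE (eqP (red v)).
  (* The quotient is 1 rather than the default value of [0 / 0] because [V] is nonempty and all its
     vertices are red. *)
  rewrite /red_proportion reds_all divff // pnatr_eq0 -lt0n.
  have /card_gt0P[v _] : (0 < #|V|)%N := ltnW V2.
  by apply/card_gt0P; exists v; rewrite inE (eqP (red v)).
- exact: consensus_potential_ge0.
- exact: (consensus_potential_le R V2).
- exact: (consensus_potential_lt V2).
Qed.
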